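(* Let $\alpha=a_1\mathbf{e}_1+a_2\mathbf{e}_2\preceq\beta=b_1\mathbf{e}_1+b_2\mathbf{e}_2$ be hyperbolic numbers and let $F:[\alpha,\beta]_{\mathbf{k}}\to\mathbb{K}$ be a hyperbolic-valued function of bounded variation whose components depend only on the respective component of the variable, i.e. $F(x_1\mathbf{e}_1+x_2\mathbf{e}_2)=F_1(x_1)\mathbf{e}_1+F_2(x_2)\mathbf{e}_2$ with $F_1:[a_1,b_1]\to\mathbb{R}$ and $F_2:[a_2,b_2]\to\mathbb{R}$. Then the set of all discontinuity points of $F$ has zero (two-dimensional) Lebesgue measure in the Euclidean plane.
   Context: Hyperbolic numbers: $\mathbb{K}=\{t+s\mathbf{k}: t,s\in\mathbb{R}\}$ with $\mathbf{k}^2=1$, $\mathbf{k}\notin\mathbb{R}$, a commutative ring. Put $\mathbf{e}_1=\frac{1+\mathbf{k}}{2}$, $\mathbf{e}_2=\frac{1-\mathbf{k}}{2}$; these are idempotents with $\mathbf{e}_1\mathbf{e}_2=0$, every $\alpha\in\mathbb{K}$ is uniquely $a_1\mathbf{e}_1+a_2\mathbf{e}_2$ with $a_1,a_2\in\mathbb{R}$, and operations are componentwise in this representation; $\mathbb{K}$ is identified with the Euclidean plane via $a_1\mathbf{e}_1+a_2\mathbf{e}_2\leftrightarrow(a_1,a_2)$. Order: $\alpha\preceq\beta$ iff $a_1\le b_1$ and $a_2\le b_2$; $\alpha\prec\beta$ iff $a_1<b_1$ and $a_2<b_2$. Interval: $[\alpha,\beta]_{\mathbf{k}}=\{\xi\in\mathbb{K}:\alpha\preceq\xi\preceq\beta\}$.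 Modulus: $|\alpha|_{\mathbf{k}}=|a_1|\mathbf{e}_1+|a_2|\mathbf{e}_2$. Continuity: $F$ is continuous at $\xi$ if for every $\epsilon\in\mathbb{K}$ with $0\prec\epsilon$ there is $\delta\in\mathbb{K}$ with $0\prec\delta$ such that $|\xi-\zeta|_{\mathbf{k}}\prec\delta$ ($\zeta$ in the domain) implies $|F(\xi)-F(\zeta)|_{\mathbf{k}}\prec\epsilon$. Strong partition of $[\alpha,\beta]_{\mathbf{k}}$: a finite collection of pairwise distinct points $\mathfrak{P}=\{\rho_0,\dots,\rho_n\}\subset[\alpha,\beta]_{\mathbf{k}}$ with $\alpha=\rho_0\preceq\rho_1\preceq\dots\preceq\rho_n=\beta$. Bounded variation: $F:[\alpha,\beta]_{\mathbf{k}}\to\mathbb{K}$ has bounded variation if, as $\mathfrak{P}=\{\rho_0,\dots,\rho_n\}$ ranges over all strong partitions of $[\alpha,\beta]_{\mathbf{k}}$, both the $\mathbf{e}_1$-components and the $\mathbf{e}_2$-components of the hyperbolic numbers $\sum_{j=0}^{n-1}|F(\rho_{j+1})-F(\rho_j)|_{\mathbf{k}}$ form bounded sets of real numbers. *)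

(* Defs.v *)
From HB Require Import structures.
From mathcomp Require Import all_boot all_order all_algebra.
From mathcomp Require Import all_classical all_reals all_analysis.
From mathcomp Require Import ring lra.
Set Implicit Arguments.
Unset Strict Implicit.
Unset Printing Implicit Defensive.
Import Order.TTheory GRing.Theory Num.Theory.
Import numFieldNormedType.Exports.
Local Open Scope classical_set_scope.
Local Open Scope ring_scope.

(* [Hyper t s] is the hyperbolic number t + s k. *)
Record hyper (R : Type) : Type := Hyper { hreal : R; hunreal : R }.

Section HyperAlgebra.
Variable R : realType.
Implicit Types (x y z : hyper R) (a b : R).

Definition hyper_pair x : R * R := (hreal x, hunreal x).
Definition pair_hyper (p : R * R) : hyper R := Hyper p.1 p.2.

Lemma hyper_pairK : cancel hyper_pair pair_hyper.
Proof. by case. Qed.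

HB.instance Definition _ := Choice.copy (hyper R) (can_type hyper_pairK).

Lemma hyperP x y : hreal x = hreal y -> hunreal x = hunreal y -> x = y.
Proof. by case: x y => [t s] [t' s'] /= -> ->. Qed.

Definition hzero : hyper R := Hyper 0 0.
Definition hone : hyper R := Hyper 1 0.
Definition hopp x : hyper R := Hyper (- hreal x) (- hunreal x).
Definition hadd x y : hyper R :=
  Hyper (hreal x + hreal y) (hunreal x + hunreal y).
(* (t + s k) (t' + s' k) expanded with k^2 = 1. *)
Definition hmul x y : hyper R :=
  Hyper (hreal x * hreal y + hunreal x * hunreal y)
        (hreal x * hunreal y + hunreal x * hreal y).
Definition hscale a x : hyper R := Hyper (a * hreal x) (a * hunreal x).

Lemma haddA : associative hadd.
Proof. by move=> x y z; apply: hyperP; rewrite /= addrA. Qed.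
Lemma haddC : commutative hadd.
Proof. by move=> x y; apply: hyperP; rewrite /= addrC. Qed.
Lemma hadd0 : left_id hzero hadd.
Proof. by move=> x; apply: hyperP; rewrite /= add0r. Qed.
Lemma haddN : left_inverse hzero hopp hadd.
Proof. by move=> x; apply: hyperP; rewrite /= addNr. Qed.

HB.instance Definition _ :=
  GRing.isZmodule.Build (hyper R) haddA haddC hadd0 haddN.

Lemma hmulA : associative hmul.
Proof. by move=> x y z; apply: hyperP => /=; ring. Qed.
Lemma hmulC : commutative hmul.
Proof. by move=> x y; apply: hyperP => /=; ring. Qed.
Lemma hmul1 : left_id hone hmul.
Proof. by move=> x; apply: hyperP => /=; ring. Qed.
Lemma hmulDl : left_distributive hmul hadd.
Proof. by move=> x y z; apply: hyperP => /=; ring. Qed.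
Lemma hone_neq0 : hone != 0.
Proof. by apply/eqP => -[] /eqP; rewrite oner_eq0. Qed.

HB.instance Definition _ := GRing.Zmodule_isComNzRing.Build (hyper R)
  hmulA hmulC hmul1 hmulDl hone_neq0.

Lemma hscaleA a b x : hscale a (hscale b x) = hscale (a * b) x.
Proof. by apply: hyperP; rewrite /= mulrA. Qed.
Lemma hscale1 : left_id 1 hscale.
Proof. by move=> x; apply: hyperP; rewrite /= mul1r. Qed.
Lemma hscaleDr : right_distributive hscale +%R.
Proof. by move=> a x y; apply: hyperP; rewrite /= mulrDr. Qed.
Lemma hscaleDl x : {morph hscale^~ x : a b / a + b}.
Proof. by move=> a b; apply: hyperP; rewrite /= mulrDl. Qed.

HB.instance Definition _ := GRing.Zmodule_isLmodule.Build R (hyper R)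
  hscaleA hscale1 hscaleDr hscaleDl.

Lemma hscaleAl a x y : a *: (x * y) = (a *: x) * y.
Proof. by apply: hyperP => /=; ring. Qed.

HB.instance Definition _ := GRing.Lmodule_isLalgebra.Build R (hyper R) hscaleAl.
HB.instance Definition _ := GRing.Lalgebra_isComAlgebra.Build R (hyper R).

Definition hk : hyper R := Hyper 0 1.
Definition e1 : hyper R := 2^-1 *: (1 + hk).
Definition e2 : hyper R := 2^-1 *: (1 - hk).

(* t + s k = (t + s) e1 + (t - s) e2, see [hyper_idempotent]. *)
Definition comp1 x : R := hreal x + hunreal x.
Definition comp2 x : R := hreal x - hunreal x.

Lemma hyperE x : x = (hreal x)%:A + hunreal x *: hk.
Proof. by apply: hyperP => /=; ring. Qed.

Lemma hk_sqr : hk * hk = 1.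
Proof. by apply: hyperP => /=; ring. Qed.

Lemma hk_notreal a : hk <> a%:A.
Proof. by move=> /(congr1 (@hunreal R)) /=; lra. Qed.

Lemma e1_idem : e1 * e1 = e1.
Proof. by apply: hyperP => /=; field. Qed.
Lemma e2_idem : e2 * e2 = e2.
Proof. by apply: hyperP => /=; field. Qed.
Lemma e1e2 : e1 * e2 = 0.
Proof. by apply: hyperP => /=; field. Qed.

Lemma hyper_idempotent x : x = comp1 x *: e1 + comp2 x *: e2.
Proof. by apply: hyperP; rewrite /= /comp1 /comp2; field. Qed.

Lemma comp1E a b : comp1 (a *: e1 + b *: e2) = a.
Proof. by rewrite /comp1 /=; field. Qed.
Lemma comp2E a b : comp2 (a *: e1 + b *: e2) = b.
Proof. by rewrite /comp2 /=; field. Qed.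

End HyperAlgebra.

Arguments e1 {R}.
Arguments e2 {R}.
Arguments hk {R}.

Section HyperAnalysis.
Variable R : realType.
Implicit Types (x y alpha beta : hyper R) (F : hyper R -> hyper R).

(* [hlt] is strict in both components, so it is not the strict part of [hle]. *)
Definition hle x y : bool := (comp1 x <= comp1 y) && (comp2 x <= comp2 y).
Definition hlt x y : bool := (comp1 x < comp1 y) && (comp2 x < comp2 y).

Definition hitv alpha beta : set (hyper R) :=
  [set x | hle alpha x /\ hle x beta].

Definition hmod x : hyper R := `|comp1 x| *: e1 + `|comp2 x| *: e2.

Definition hcontinuous_at (D : set (hyper R)) F x : Prop :=
  forall eps, hlt 0 eps ->
    exists2 delta, hlt 0 delta &
      forall z, D z -> hlt (hmod (x - z)) delta -> hlt (hmod (F x - F z)) eps.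

Definition discontinuities (D : set (hyper R)) F : set (hyper R) :=
  [set x | D x /\ ~ hcontinuous_at D F x].

(* The points are rho 0, ..., rho n; later values of rho are irrelevant. *)
Definition strong_partition alpha beta (n : nat) (rho : nat -> hyper R) : Prop :=
  [/\ forall j, (j <= n)%N -> hitv alpha beta (rho j),
      forall i j, (i <= n)%N -> (j <= n)%N -> rho i = rho j -> i = j,
      rho 0%N = alpha,
      rho n = beta &
      forall j, (j < n)%N -> hle (rho j) (rho j.+1)].

Definition hvariations alpha beta F : set (hyper R) :=
  [set v | exists n rho, strong_partition alpha beta n rho /\
     v = \sum_(0 <= j < n) hmod (F (rho j.+1) - F (rho j))].

Definition hbounded_variation alpha beta F : Prop :=
  bounded_set (@comp1 R @` hvariations alpha beta F) /\
  bounded_set (@comp2 R @` hvariations alpha beta F).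

Definition plane x : R * R := (comp1 x, comp2 x).

Definition lebesgue_measure2 :
    set (measurableTypeR R * measurableTypeR R) -> \bar R :=
  (@lebesgue_measure R \x @lebesgue_measure R)%E.

(* Null sets of the completed measure: subsets of Borel sets of measure 0. *)
Definition lebesgue_null2 (A : set (measurableTypeR R * measurableTypeR R)) :
    Prop :=
  lebesgue_measure2.-negligible A.

End HyperAnalysis.

(* Main.v *)
(** A real function [f] of bounded variation on [[a, b]] satisfies
    [|f x - f y| <= |V x - V y|], where [V] is its total variation function.
    Since [V] is monotone, it has only countably many jumps, and [f] is
    continuous at every interior point at which [V] does not jump.

    A partition of one side of the rectangle extends to a strong partition of
    the rectangle by freezing the other component until the last point, so [F1]
    and [F2] have bounded variation. As [F] is continuous at [x] as soon as
    [F1] and [F2] are continuous at the components of [x], its discontinuities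
    are covered by countably many horizontal and vertical lines. *)

Require Import Defs.
From HB Require Import structures.
From mathcomp Require Import all_boot all_order all_algebra.
From mathcomp Require Import all_classical all_reals all_analysis.
From mathcomp Require Import lra.
Set Implicit Arguments.
Unset Strict Implicit.
Unset Printing Implicit Defensive.
Import Order.TTheory GRing.Theory Num.Theory.
Import numFieldNormedType.Exports.
Local Open Scope classical_set_scope.
Local Open Scope ring_scope.

Lemma countableU (T : Type) (A B : set T) :
  countable A -> countable B -> countable (A `|` B).
Proof.
by move=> cA cB; rewrite -bigcup2E; apply: bigcup_countable => // -[|[|i]] _.
Qed.

(** * Real functions of bounded variation and their discontinuities *)

Section real_bounded_variation.
Context {R : realType}.
Implicit Types (a b x y : R) (f : R -> R).

(** On a left neighbourhood of [x] inside the interval, [f] is monotone and bounded above by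
    [f x]. *)
Lemma nondecreasing_is_cvg_at_left a b x f :
  {in `[a, b] &, nondecreasing_fun f} -> x \in `]a, b[ ->
  cvg (f y @[y --> x^'-]).
Proof.
move=> ndf xab; have /andP[ax xb] : a < x < b by move: xab; rewrite in_itv.
apply: nondecreasing_at_left_is_cvgr; near=> r.
- apply: itv_sub_in2 ndf; apply: (subset_itvW _ _ _ (ltW xb)).
  by near: r; exact: nbhs_left_ge.
- exists (f x) => _/= [z zrx <-]; apply: ndf.
  + apply: (subset_itvW _ _ _ (ltW xb) zrx).
    by near: r; exact: nbhs_left_ge.
  + exact: subset_itv_oo_cc.
  + by move: zrx => /[!in_itv]/= /andP[_ /ltW].
Unshelve. all: by end_near. Qed.

Lemma nondecreasing_is_cvg_at_right a b x f :
  {in `[a, b] &, nondecreasing_fun f} -> x \in `]a, b[ ->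
  cvg (f y @[y --> x^'+]).
Proof.
move=> ndf xab; have /andP[ax xb] : a < x < b by move: xab; rewrite in_itv.
apply: nondecreasing_at_right_is_cvgr; near=> r.
- apply: itv_sub_in2 ndf; apply: (subset_itvW _ _ (ltW ax)).
  by near: r; exact: nbhs_right_le.
- exists (f x) => _/= [z zxr <-]; apply: ndf.
  + exact: subset_itv_oo_cc.
  + apply: (subset_itvW _ _ (ltW ax) _ zxr).
    by near: r; exact: nbhs_right_le.
  + by move: zxr => /[!in_itv]/= /andP[/ltW].
Unshelve. all: by end_near. Qed.

(** A [discontinuity] is a difference between the one-sided limits. Without it they share a value,
    and [y], [z] are taken so close to [x] that [f y] and [f z] are within [eps / 2] of that
    value. *)
Lemma nondecreasing_not_discontinuity a b x f :
  {in `[a, b] &, nondecreasing_fun f} -> x \in `]a, b[ ->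
  ~ discontinuity f x -> forall eps : R, 0 < eps ->
  exists y z, [/\ a < y < x, x < z < b & f z - f y < eps].
Proof.
move=> ndf xab xNd eps eps0.
have /andP[ax xb] : a < x < b by move: xab; rewrite in_itv.
have cl := nondecreasing_is_cvg_at_left ndf xab.
have cr := nondecreasing_is_cvg_at_right ndf xab.
have lr : lim (f y @[y --> x^'-]) = lim (f y @[y --> x^'+]).
  by apply/eqP/negPn/negP => ?; exact: xNd.
have eps20 : 0 < eps / 2 by rewrite divr_gt0.
move/cvgrPdist_lt/(_ _ eps20) : cl => cl.
move/cvgrPdist_lt/(_ _ eps20) : cr => cr.
near x^'- => y; near x^'+ => z; exists y, z; split.
- by apply/andP; split; near: y; [exact: nbhs_left_gt|exact: nbhs_left_lt].
- by apply/andP; split; near: z; [exact: nbhs_right_gt|exact: nbhs_right_lt].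
have : `|lim (f y @[y --> x^'-]) - f y| < eps / 2 by near: y.
have : `|lim (f y @[y --> x^'+]) - f z| < eps / 2 by near: z.
rewrite lr !ltr_norml => /andP[? ?] /andP[? ?]; lra.
Unshelve. all: by end_near. Qed.

Lemma fine_total_variation_nondecreasing a b f : bounded_variation a b f ->
  {in `[a, b] &, nondecreasing_fun (fine \o total_variation a ^~ f)}.
Proof.
move=> bvf x y xab yab xy.
move: (xab) (yab); rewrite !in_itv/= => /andP[ax xb] /andP[ay yb].
apply: fine_le.
- exact/(bounded_variationP _ ax)/(bounded_variationl ax xb).
- exact/(bounded_variationP _ ay)/(bounded_variationl ay yb).
- exact: (@total_variation_nondecreasing _ _ b).
Qed.

(** Total variation is additive over [[a, x]] and [[x, y]], and on [[x, y]] it dominates the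
    increment of [f]. Finiteness allows the subtraction in the reals. *)
Lemma dist_le_total_variation a b f x y : bounded_variation a b f ->
  a <= x -> x <= y -> y <= b ->
  `|f y - f x| <=
    fine (total_variation a y f) - fine (total_variation a x f).
Proof.
move=> bvf ax xy yb; have ay := le_trans ax xy; have xb := le_trans xy yb.
have finx : total_variation a x f \is a fin_num.
  exact/(bounded_variationP _ ax)/(bounded_variationl ax xb).
have finy : total_variation a y f \is a fin_num.
  exact/(bounded_variationP _ ay)/(bounded_variationl ay yb).
rewrite -lee_fin EFinB !fineK// leeBrDr//.
by rewrite addeC (total_variationD f ax xy) leeD2l// total_variation_ge.
Qed.

Lemma bounded_variation_continuous_at a b f x : bounded_variation a b f ->
  x \in `]a, b[ ->
  ~ discontinuity (fine \o total_variation a ^~ f) x ->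
  f y @[y --> x] --> f x.
Proof.
move=> bvf xab xNd; apply/cvgrPdist_lt => eps eps0.
have ndV := fine_total_variation_nondecreasing bvf.
have [y [z [/andP[ay yx] /andP[xz zb]]]] :=
  nondecreasing_not_discontinuity ndV xab xNd eps0.
set V := (fun t => fine (total_variation a t f)).
rewrite -[X in X < _]/(V z - V y) => Vyz; near=> t.
have yt : y < t by near: t; exact: lt_nbhsr.
have tz : t < z by near: t; exact: lt_nbhsl.
(* Both [x] and [t] lie between [y] and [z], so monotonicity of [V] bounds the distance of [V x] and
   [V t] by [V z - V y]. *)
apply: le_lt_trans Vyz; have [xt|tx] := leP x t.
  rewrite distrC (le_trans (dist_le_total_variation bvf _ xt _))//; [lra..|].
  by apply: lerB; apply: ndV; rewrite ?in_itv/=; lra.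
rewrite (le_trans (dist_le_total_variation bvf _ (ltW tx) _))//; [lra..|].
by apply: lerB; apply: ndV; rewrite ?in_itv/=; lra.
Unshelve. all: by end_near. Qed.

Lemma bounded_variation_discontinuities_countable a b f :
  bounded_variation a b f ->
  countable [set x | x \in `[a, b] /\
                     ~ (f y @[y --> within `[a, b] (nbhs x)] --> f x)].
Proof.
move=> bvf; have ndV := fine_total_variation_nondecreasing bvf.
(* The argument with points on both sides of [x] works only in the open interval, so the two
   endpoints simply join the exceptional set. *)
apply: (@sub_countable _ _ _ ([set a; b] `|`
  [set x | x \in (`]a, b[) /\
           discontinuity (fine \o total_variation a ^~ f) x])); last first.
  apply: countableU; last exact: discontinuity_countable.
  exact/finite_set_countable/finite_set2.
apply: subset_card_le => x /= [xab xNc].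
have [->|xa] := eqVneq x a; first by left; left.
have [->|xb] := eqVneq x b; first by left; right.
have xoo : x \in `]a, b[.
  move: xab; rewrite !in_itv/= => /andP[ax xb'].
  by rewrite !lt_neqAle ax xb' xb eq_sym xa.
right; split => //; apply: contrapT => xNd; apply: xNc.
apply: cvg_trans (bounded_variation_continuous_at bvf xoo xNd).
by apply: cvg_app; exact: cvg_within.
Qed.

Lemma itv_partition_nthS a b s j : itv_partition a b s ->
  (j < size s)%N -> nth b (a :: s) j < nth b (a :: s) j.+1.
Proof. by move=> [/(pathP b) abs _] js; exact: abs. Qed.

Lemma step_le (c d : R) n j : c <= d -> (j < n)%N ->
  (if (j < n)%N then c else d) <= (if (j.+1 < n)%N then c else d).
Proof. by move=> cd ->; case: ifP. Qed.

Lemma bounded_set_le (A : set R) : bounded_set A ->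
  exists M, forall x, A x -> x <= M.
Proof.
(* [bounded_set] provides a bound by each real strictly above [M], hence [M + 1]. *)
move=> [M [_ AM]]; exists (M + 1) => x Ax.
by apply: le_trans (ler_norm x) (AM _ _ _ Ax); rewrite ltrDl.
Qed.

Lemma cvg_within_itv_dist a b f (r eps : R) :
  f y @[y --> within `[a, b] (nbhs r)] --> f r -> 0 < eps ->
  exists2 d, 0 < d &
    forall y, y \in `[a, b] -> `|r - y| < d -> `|f r - f y| < eps.
Proof.
move=> /cvgrPdist_lt fr eps0; have [d /= d0 rd] := fr _ eps0.
by exists d => // y yab ryd; exact: rd.
Qed.

End real_bounded_variation.

(** * Components of hyperbolic numbers and strong partitions *)

Section hyperbolic.
Context {R : realType}.
Implicit Types (x y alpha beta : hyper R).

Lemma comp1D x y : comp1 (x + y) = comp1 x + comp1 y.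
Proof. by rewrite /comp1/= addrACA. Qed.

Lemma comp2D x y : comp2 (x + y) = comp2 x + comp2 y.
Proof. by rewrite /comp2/= opprD addrACA. Qed.

Lemma comp1B x y : comp1 (x - y) = comp1 x - comp1 y.
Proof. by rewrite /comp1/=; lra. Qed.

Lemma comp2B x y : comp2 (x - y) = comp2 x - comp2 y.
Proof. by rewrite /comp2/=; lra. Qed.

Lemma comp1_0 : comp1 (0 : hyper R) = 0.
Proof. by rewrite /comp1/= addr0. Qed.

Lemma comp2_0 : comp2 (0 : hyper R) = 0.
Proof. by rewrite /comp2/= subrr. Qed.

Lemma comp1_hmod x : comp1 (hmod x) = `|comp1 x|.
Proof. exact: comp1E. Qed.

Lemma comp2_hmod x : comp2 (hmod x) = `|comp2 x|.
Proof. exact: comp2E. Qed.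

Lemma hitvP alpha beta x : hitv alpha beta x <->
  comp1 x \in `[comp1 alpha, comp1 beta] /\
  comp2 x \in `[comp2 alpha, comp2 beta].
Proof.
rewrite /hitv /hle /= !in_itv/=.
by split=> [[/andP[-> ->] /andP[-> ->]]|[/andP[-> ->] /andP[-> ->]]].
Qed.

(** Either coordinate may stall, as a frozen one does; strict growth of one of them at each step
    suffices for distinct points. *)
Lemma strong_partition_comp alpha beta n (t u : nat -> R) :
  t 0%N = comp1 alpha -> t n = comp1 beta ->
  u 0%N = comp2 alpha -> u n = comp2 beta ->
  (forall j, (j < n)%N -> t j <= t j.+1) ->
  (forall j, (j < n)%N -> u j <= u j.+1) ->
  (forall j, (j < n)%N -> (t j < t j.+1) || (u j < u j.+1)) ->
  strong_partition alpha beta n (fun j => t j *: e1 + u j *: e2).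
Proof.
move=> t0 tn u0 un tS uS tuS.
have mono (v : nat -> R) : (forall j, (j < n)%N -> v j <= v j.+1) ->
    forall i j, (i <= j)%N -> (j <= n)%N -> v i <= v j.
  move=> vS i; elim=> [|j ih]; first by rewrite leqn0 => /eqP ->.
  rewrite leq_eqVlt => /predU1P[->//|]; rewrite ltnS => ij jn.
  exact: le_trans (ih ij (ltnW jn)) (vS _ jn).
(* If points [i < j] coincide, monotonicity forces both coordinates to be constant from [i] to [j],
   against the strict growth at step [i]. *)
have inj i j : (i < j)%N -> (j <= n)%N ->
    t i *: e1 + u i *: e2 <> t j *: e1 + u j *: e2 :> hyper R.
  move=> ij jn eij.
  have tij : t i = t j by rewrite -(comp1E (t i) (u i)) eij comp1E.
  have uij : u i = u j by rewrite -(comp2E (t i) (u i)) eij comp2E.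
  have := tuS _ (leq_trans ij jn).
  have := mono _ tS _ _ ij jn; have := mono _ uS _ _ ij jn.
  by rewrite -tij -uij !leNgt => /negbTE -> /negbTE ->.
split.
- move=> j jn; apply/hitvP; rewrite comp1E comp2E !in_itv/= -t0 -tn -u0 -un.
  by rewrite !mono.
- move=> i j iln jln eij; apply/eqP; rewrite eqn_leq.
  apply/andP; split; rewrite leqNgt; apply/negP => ltij.
  + exact: inj ltij iln (esym eij).
  + exact: inj ltij jln eij.
- by rewrite t0 u0 -hyper_idempotent.
- by rewrite tn un -hyper_idempotent.
- by move=> j jn; rewrite /hle !comp1E !comp2E tS ?uS.
Qed.

(** * Transfer between [F] and its components *)

Variables (alpha beta : hyper R) (F : hyper R -> hyper R) (F1 F2 : R -> R).
Hypothesis le_ab : hle alpha beta.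
Hypothesis F_comp : forall x1 x2 : R,
  hitv alpha beta (x1 *: e1 + x2 *: e2) ->
  F (x1 *: e1 + x2 *: e2) = F1 x1 *: e1 + F2 x2 *: e2.

Lemma comp1_F x : hitv alpha beta x -> comp1 (F x) = F1 (comp1 x).
Proof. by rewrite (hyper_idempotent x) => /F_comp ->; rewrite !comp1E. Qed.

Lemma comp2_F x : hitv alpha beta x -> comp2 (F x) = F2 (comp2 x).
Proof. by rewrite (hyper_idempotent x) => /F_comp ->; rewrite !comp2E. Qed.

Lemma comp1_variation n rho : strong_partition alpha beta n rho ->
  comp1 (\sum_(0 <= j < n) hmod (F (rho j.+1) - F (rho j))) =
  \sum_(0 <= j < n) `|F1 (comp1 (rho j.+1)) - F1 (comp1 (rho j))|.
Proof.
move=> [rab _ _ _ _]; rewrite (big_morph _ comp1D comp1_0).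
apply: eq_big_nat => j /andP[_ jn].
rewrite comp1_hmod comp1B !comp1_F//; apply: rab => //; exact: ltnW.
Qed.

Lemma comp2_variation n rho : strong_partition alpha beta n rho ->
  comp2 (\sum_(0 <= j < n) hmod (F (rho j.+1) - F (rho j))) =
  \sum_(0 <= j < n) `|F2 (comp2 (rho j.+1)) - F2 (comp2 (rho j))|.
Proof.
move=> [rab _ _ _ _]; rewrite (big_morph _ comp2D comp2_0).
apply: eq_big_nat => j /andP[_ jn].
rewrite comp2_hmod comp2B !comp2_F//; apply: rab => //; exact: ltnW.
Qed.

Lemma hbounded_variation_comp1 : hbounded_variation alpha beta F ->
  bounded_variation (comp1 alpha) (comp1 beta) F1.
Proof.
move=> [/bounded_set_le[M FM] _].
(* The degenerate side is set apart: there [s] is empty, and a single index cannot carry both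
   [comp2 alpha] and [comp2 beta]. *)
have [->|ab] := eqVneq (comp1 alpha) (comp1 beta).
  exact: bounded_variationxx.
exists M => _ [s abs <-].
have s0 : (0 < size s)%N.
  by case: s abs => // /itv_partition_nil /eqP; rewrite (negbTE ab).
have /andP[_ le2] := le_ab.
(* [t] enumerates the points as [variation] does, so the first component of the hyperbolic sum is
   the variation of [F1] along [s]. *)
pose t := nth (comp1 beta) (comp1 alpha :: s).
pose u j := if (j < size s)%N then comp2 alpha else comp2 beta.
have sp : strong_partition alpha beta (size s)
    (fun j => t j *: e1 + u j *: e2).
  apply: strong_partition_comp => //.
  - exact: itv_partition_nth_size.
  - by rewrite /u s0.
  - by rewrite /u ltnn.
  - by move=> j js; exact/ltW/itv_partition_nthS.
  - by move=> j js; exact: step_le.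
  - by move=> j js; rewrite itv_partition_nthS.
apply: FM; eexists; first by exists (size s); eexists; split; [exact: sp|].
by rewrite comp1_variation//; apply: eq_bigr => j _; rewrite !comp1E.
Qed.

(** The same construction with the first coordinate frozen. *)
Lemma hbounded_variation_comp2 : hbounded_variation alpha beta F ->
  bounded_variation (comp2 alpha) (comp2 beta) F2.
Proof.
move=> [_ /bounded_set_le[M FM]].
have [->|ab] := eqVneq (comp2 alpha) (comp2 beta).
  exact: bounded_variationxx.
exists M => _ [s abs <-].
have s0 : (0 < size s)%N.
  by case: s abs => // /itv_partition_nil /eqP; rewrite (negbTE ab).
have /andP[le1 _] := le_ab.
pose t j := if (j < size s)%N then comp1 alpha else comp1 beta.
pose u := nth (comp2 beta) (comp2 alpha :: s).
have sp : strong_partition alpha beta (size s)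
    (fun j => t j *: e1 + u j *: e2).
  apply: strong_partition_comp => //.
  - by rewrite /t s0.
  - by rewrite /t ltnn.
  - exact: itv_partition_nth_size.
  - by move=> j js; exact: step_le.
  - by move=> j js; exact/ltW/itv_partition_nthS.
  - by move=> j js; rewrite orbC itv_partition_nthS.
apply: FM; eexists; first by exists (size s); eexists; split; [exact: sp|].
by rewrite comp2_variation//; apply: eq_bigr => j _; rewrite !comp2E.
Qed.

Lemma hcontinuous_at_comp x : hitv alpha beta x ->
  F1 y @[y --> within `[comp1 alpha, comp1 beta] (nbhs (comp1 x))] -->
    F1 (comp1 x) ->
  F2 y @[y --> within `[comp2 alpha, comp2 beta] (nbhs (comp2 x))] -->
    F2 (comp2 x) ->
  hcontinuous_at (hitv alpha beta) F x.
Proof.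
move=> xab c1 c2 eps; rewrite /hlt comp1_0 comp2_0 => /andP[eps1 eps2].
have [d1 d10 F1d] := cvg_within_itv_dist c1 eps1.
have [d2 d20 F2d] := cvg_within_itv_dist c2 eps2.
(* Order and modulus act componentwise, so the two real radii can be chosen independently and
   combined. *)
exists (d1 *: e1 + d2 *: e2); first by rewrite comp1E comp2E d10.
move=> z zab; rewrite !comp1_hmod !comp2_hmod comp1E comp2E.
rewrite !comp1B !comp2B !comp1_F// !comp2_F// => /andP[zd1 zd2].
by move/hitvP : zab => [z1 z2]; rewrite F1d ?F2d.
Qed.

End hyperbolic.

(** * Null sets in the plane *)

Lemma lebesgue_measure2X (R : realType) (A B : set (measurableTypeR R)) :
  measurable A -> measurable B ->
  lebesgue_measure2 (A `*` B) = (lebesgue_measure A * lebesgue_measure B)%E.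
Proof. by move=> mA mB; exact: product_measure1E. Qed.

Lemma countable_measurableTypeR (R : realType) (A : set (measurableTypeR R)) :
  countable A -> measurable A.
Proof. by apply: countable_measurable => t; exact: measurable_set1. Qed.

Lemma negligible_countable_cross (R : realType)
    (A B : set (measurableTypeR R)) :
  countable A -> countable B ->
  lebesgue_null2 ((A `*` setT) `|` (setT `*` B)).
Proof.
move=> cA cB; have mA := countable_measurableTypeR cA.
have mB := countable_measurableTypeR cB.
apply: negligibleU; [exists (A `*` setT)|exists (setT `*` B)]; split => //.
- exact: measurableX.
- apply: etrans (lebesgue_measure2X mA measurableT) _.
  by rewrite countable_lebesgue_measure0// mul0e.
- exact: measurableX.
- apply: etrans (lebesgue_measure2X measurableT mB) _.
  by rewrite (countable_lebesgue_measure0 cB) mule0.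
Qed.

Theorem theorem4p7 (R : realType) (alpha beta : hyper R)
    (F : hyper R -> hyper R) (F1 F2 : R -> R)
    (le_ab : hle alpha beta)
    (F_bv : hbounded_variation alpha beta F)
    (F_comp : forall x1 x2 : R,
       hitv alpha beta (x1 *: e1 + x2 *: e2) ->
       F (x1 *: e1 + x2 *: e2) = F1 x1 *: e1 + F2 x2 *: e2) :
  lebesgue_null2 (@plane R @` discontinuities (hitv alpha beta) F).
Proof.
have D1 := bounded_variation_discontinuities_countable
  (hbounded_variation_comp1 le_ab F_comp F_bv).
have D2 := bounded_variation_discontinuities_countable
  (hbounded_variation_comp2 le_ab F_comp F_bv).
apply: negligibleS (negligible_countable_cross D1 D2).
move=> _ [x [xab xNc] <-] /=; have [x1 x2] := (hitvP _ _ _).1 xab.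
apply: contrapT => /not_orP[/not_andP xD1 /not_andP xD2]; apply: xNc.
apply: (hcontinuous_at_comp F_comp) => //; apply: contrapT => Nc.
- by case: xD1; apply => //; split.
- by case: xD2; apply => //; split.
Qed.
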